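(* Let $X$ be a real random variable with a unimodal distribution with mode at $0$ and with first absolute moment $E|X| = 1$. Then $$P(|X| \geq v) \leq \begin{cases} \dfrac{1}{2v}, & v \geq 1, \\[2mm] 1 - \dfrac v2, & 0 \leq v \leq 1. \end{cases}$$ Moreover, for given $v \ge 0$, equality holds if, with $c = 2\max\{v,1\}$, the distribution of $X$ is the mixture of the uniform distribution on $(-c,c)$ and the distribution degenerate at $0$ in which the point mass at $0$ equals $\max\{1-2/c,\,0\}$ (so the uniform component has weight $1-\max\{1-2/c,0\}$).
   Context: A real random variable $X$ (or its distribution) is called unimodal with mode at $\nu$ if its distribution function is convex on $(-\infty,\nu)$ and concave on $(\nu,\infty)$. Equivalently, apart from a possible point mass at $\nu$, the distribution has a density that is nondecreasing on $(-\infty,\nu)$ and nonincreasing on $(\nu,\infty)$. In particular, a point mass at the mode is allowed. *)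

(* Defs.v *)
From HB Require Import structures.
From mathcomp Require Import all_boot all_order all_algebra.
From mathcomp Require Import all_classical all_reals all_analysis.

Set Implicit Arguments.
Unset Strict Implicit.
Unset Printing Implicit Defensive.

Import Order.TTheory GRing.Theory Num.Theory.
Import numFieldNormedType.Exports.

Local Open Scope classical_set_scope.
Local Open Scope ring_scope.

(* [cdf X] takes values in [\bar R] but is always finite, so [fine] loses
   nothing; concavity is stated as convexity of the opposite function. *)
Definition unimodal d (T : measurableType d) (R : realType)
    (P : probability T R) (X : {RV P >-> R}) (nu : R) : Prop :=
  convex_function (E := R^o) `]-oo, nu[ (fun x => fine (cdf X x)) /\
  convex_function (E := R^o) `]nu, +oo[ (fun x => - fine (cdf X x)).

(* The two branches agree at [v = 1]. *)
Definition tail_bound (R : realType) (v : R) : R :=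
  if 1 <= v then 1 / (2 * v) else 1 - v / 2.

Definition half_width (R : realType) (v : R) : R := 2 * Num.max v 1.

Lemma half_width_ltN (R : realType) (v : R) : - half_width v < half_width v.
Proof.
have c0 : 0 < half_width v by rewrite /half_width mulr_gt0// lt_max ltr01 orbT.
by rewrite (lt_trans _ c0)// oppr_lt0.
Qed.

Definition mass0 (R : realType) (v : R) : R :=
  Num.max (1 - 2 / half_width v) 0.

(* [uniform_prob] has its density supported by the closed interval, which
   gives the same measure as the open one. *)
Definition extremal_law (R : realType) (v : R) (A : set R) : \bar R :=
  ((mass0 v)%:E * \d_(0%R : R) A +
   (1 - mass0 v)%:E * uniform_prob (half_width_ltN v) A)%E.

(* Main.v *)
Require Import Defs.
From HB Require Import structures.
From mathcomp Require Import all_boot all_order all_algebra.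
From mathcomp Require Import all_classical all_reals all_analysis.
From mathcomp Require Import measurable_realfun ring lra.
Import Order.TTheory GRing.Theory Num.Theory.
Import numFieldNormedType.Exports.
Local Open Scope classical_set_scope.
Local Open Scope ring_scope.

(** Let G(t) = P(|X| > t).  Unimodality at 0 makes G convex on the positive
    half-line, because 1 - F is convex there and so is t |-> F(-t).  Two
    consequences give the bound.

    Hermite-Hadamard: the graph of a convex function lies above its tangent at
    t, so the mean of G over (0, 2t) is at least G(t).  Since E|X| is the
    integral of G over the half-line,
    1 = E|X| >= int_0^(2t) G >= 2 t G(t), that is, G(t) <= 1 / (2 t)
    ([outer_hermite_hadamard]).

    Chord: at t = 1 this reads G(1) <= 1/2, and G <= 1 near 0, so on (0, 1)
    convexity keeps G below the chord 1 - t / 2 ([outer_chord]).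

    The proof replaces the integral by a Riemann sum with step h: E|X| is at
    least h times the sum of the tails at h, 2h, ..., nh
    ([expectation_ge_tail_sum]), and pairing kh with (n + 1 - k)h bounds such a
    sum of convex values below by n times the value at the midpoint
    ([midpoint_le_arithmetic_sum]).  The convex function used is
    P(X <= -t or X > t) ([outer]), which is expressed by the distribution
    function alone and lies between P(|X| > t) and P(|X| >= t); letting its
    argument increase to v gives the bound on P(|X| >= v).

    For the mixture with half-width c the uniform part has weight 2 / c, which
    gives E|X| = (2 / c) (c / 2) = 1 and P(|X| >= v) = (2 / c) (1 - v / c) for
    v > 0; the choice of c turns the latter into the bound.  Its distribution
    function is, up to constants and sign, the positive part of an affine
    function on each side of 0, hence unimodal. *)

(** * Convexity along a segment of the real line *)

(** Unfolds the convex-space structure into the usual inequality, on which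
    arithmetic decision procedures can work. *)
Lemma convex_function_on_RP (R : realType) (D : set R) (f : R -> R) :
  convex_function (E := R^o) D f <->
  (forall s x y : R, 0 <= s <= 1 -> D x -> D y ->
     f (s * x + (1 - s) * y) <= s * f x + (1 - s) * f y).
Proof.
split=> [cf s x y /andP[s0 s1] Dx Dy|cf t x y /set_mem Dx /set_mem Dy].
  exact: (cf (Itv01 s0 s1) x y (mem_set Dx) (mem_set Dy)).
by apply: cf => //; rewrite ge0 le1.
Qed.

(** A discrete Hermite-Hadamard inequality: the points h, ..., nh are symmetric
    about (n + 1) h / 2, so adding the sum to its reversal gives n pairs, each
    with that midpoint. *)
Lemma midpoint_le_arithmetic_sum (R : realType) (H : R -> R) (h : R) (n : nat) :
  (forall s x y : R, 0 <= s <= 1 -> 0 < x -> 0 < y ->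
     H (s * x + (1 - s) * y) <= s * H x + (1 - s) * H y) ->
  0 < h ->
  n%:R * H (n.+1%:R * h / 2) <= \sum_(k < n) H (k.+1%:R * h).
Proof.
move=> cH h0.
pose S := \sum_(k < n) H (k.+1%:R * h).
have S2 : S + S = \sum_(k < n) (H (k.+1%:R * h) + H ((n - k)%:R * h)).
  rewrite big_split/= {2}/S; congr (_ + _).
  rewrite (reindex_inj rev_ord_inj)/=.
  by apply: eq_bigr => k _; rewrite -subSn// subSS.
suff : n%:R * H (n.+1%:R * h / 2) *+ 2 <= S + S by rewrite -mulr2n lerMn2r.
rewrite S2 -mulrnAr mulr_natl.
have -> : (H (n.+1%:R * h / 2) *+ 2) *+ n =
    \sum_(k < n) (H (n.+1%:R * h / 2) *+ 2) by rewrite sumr_const card_ord.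
apply: ler_sum => k _.
have k0 : 0 < k.+1%:R * h by rewrite mulr_gt0.
have nk0 : 0 < (n - k)%:R * h by rewrite mulr_gt0// ltr0n subn_gt0.
have half01 : 0 <= (2^-1 : R) <= 1 by lra.
have := cH 2^-1 _ _ half01 k0 nk0.
have -> : 2^-1 * (k.+1%:R * h) + (1 - 2^-1) * ((n - k)%:R * h) =
          n.+1%:R * h / 2.
  by rewrite natrB ?(ltnW (ltn_ord k))// -!natr1; field.
by move=> mid; rewrite [leLHS]mulr2n; lra.
Qed.

(** * A lower Riemann sum for the first moment *)

(** For [h > 0] the sum counts the positive multiples of [h] up to [a]: it is the
    integer part of [a / h], capped at [n]. *)
Lemma sum_step_indicator_le (R : realType) (h a : R) (n : nat) :
  0 <= h -> 0 <= a -> h * (\sum_(k < n) (k.+1%:R * h <= a)%R%:R) <= a.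
Proof.
move=> h0 a0; elim: n => [|n IH]; first by rewrite big_ord0 mulr0.
rewrite big_ord_recr/=; case: (boolP (n.+1%:R * h <= a)) => [na|_];
  last by rewrite addr0.
apply: le_trans na; rewrite mulrC ler_wpM2r// -natr1 lerD2r.
have -> : n%:R = \sum_(k < n) 1 :> R by rewrite sumr_const card_ord.
by apply: ler_sum => k _; rewrite lern1 leq_b1.
Qed.

(** The tails decrease, so this is a lower sum for the integral of the tail,
    which is the expectation; integrating the pointwise bound
    [sum_step_indicator_le] avoids that integral. *)
Lemma expectation_ge_tail_sum d (T : measurableType d) (R : realType)
    (P : probability T R) (Y : {RV P >-> R}) (h : R) (n : nat) :
  0 <= h -> (forall w, 0 <= Y w) ->
  ((h * \sum_(k < n) fine (P [set w | (k.+1%:R * h <= Y w)%R]))%:E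
    <= 'E_P[Y])%E.
Proof.
move=> h0 Y0.
pose A (k : nat) := [set w | (k.+1%:R * h <= Y w)%R].
have mA k : measurable (A k).
  rewrite [A k](_ : _ = Y @^-1` `[k.+1%:R * h, +oo[).
    exact: measurable_funPTI.
  by apply/seteqP; split => w /=; rewrite /A/= in_itv/= andbT.
have -> : (h * \sum_(k < n) fine (P (A k)))%:E =
    (\int[P]_w (\sum_(k < n) (h * \1_(A k) w)%:E))%E.
  rewrite ge0_integral_sum//=; last 2 first.
  - by move=> k; apply/measurable_EFinP; exact: measurable_funM.
  - by move=> k w _; rewrite lee_fin mulr_ge0.
  rewrite mulr_sumr -sumEFin; apply: eq_bigr => k _.
  under eq_integral do rewrite EFinM.
  rewrite ge0_integralZl//=; last exact/measurable_EFinP/measurable_indic.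
  by rewrite integral_indic// setIT EFinM fineK// fin_num_measure.
rewrite expectation_def; apply: ge0_le_integral => //.
- by move=> w _; apply: sume_ge0 => k _; rewrite lee_fin mulr_ge0.
- apply: emeasurable_sum => k; apply/measurable_EFinP.
  exact: measurable_funM.
- exact/measurable_EFinP.
move=> w _; rewrite sumEFin lee_fin -mulr_sumr.
apply: le_trans (@sum_step_indicator_le _ h (Y w) n h0 (Y0 w)).
rewrite ler_wpM2l//; apply: ler_sum => k _.
rewrite indicE /A; case: (boolP (k.+1%:R * h <= Y w)).
  by case: (_ \in _).
by move=> hn; rewrite memNset//=; apply/negP.
Qed.

(** * The tail of a unimodal law with unit first absolute moment *)

Section tail_of_unimodal_law.
Context d (T : measurableType d) (R : realType) (P : probability T R).
Variable X : {RV P >-> R}.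

Let F (x : R) : R := fine (cdf X x).
Definition tail (t : R) : R := fine (P [set w | (t <= `|X w|)%R]).
(** This is P(X <= -t or X > t).  Including the left endpoint and not the right
    one makes it a combination of values of the distribution function, so that
    its convexity needs no continuity argument. *)
Definition outer (t : R) : R := 1 - F t + F (- t).

Lemma abs_ge_preimage (t : R) :
  [set w | (t <= `|X w|)%R] = X @^-1` (`]-oo, - t] `|` `[t, +oo[).
Proof.
apply/seteqP; split => w /=; rewrite !in_itv/= ?andbT lerNr ler_normr.
  by case/orP; [right|left].
by case=> ->; rewrite ?orbT.
Qed.

Lemma measurable_abs_ge (t : R) : measurable [set w | (t <= `|X w|)%R].
Proof.
rewrite abs_ge_preimage; apply: measurable_funPTI; exact: measurableU.
Qed.

Lemma outerE (t : R) : 0 < t ->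
  (outer t)%:E = P (X @^-1` (`]-oo, - t] `|` `]t, +oo[)).
Proof.
move=> t0; rewrite preimage_setU measureU//=; last 3 first.
- exact: measurable_funPTI.
- exact: measurable_funPTI.
- apply/seteqP; split => w //= [] /=; rewrite !in_itv/= andbT => a b.
  lra.
rewrite addeC -/(cdf X (- t)) -[X in (X + _)%E]/(ccdf X t) ccdf_1_cdf.
by rewrite /outer EFinD EFinB /F !fineK// fin_num_measure.
Qed.

(** The endpoint [t] may carry mass that [outer t] misses, hence the smaller
    argument [u]. *)
Lemma tail_le_outer (t u : R) : 0 < u -> u < t -> tail t <= outer u.
Proof.
move=> u0 ut; rewrite -lee_fin outerE// /tail fineK; last first.
  by rewrite fin_num_measure//; exact: measurable_abs_ge.
rewrite abs_ge_preimage; apply: le_measure; rewrite ?inE//.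
- by apply: measurable_funPTI; exact: measurableU.
- by apply: measurable_funPTI; exact: measurableU.
apply: preimage_subset => x /=; rewrite !in_itv/= !andbT.
by case=> ?; [left|right]; lra.
Qed.

Lemma outer_le_tail (t : R) : 0 < t -> outer t <= tail t.
Proof.
move=> t0; rewrite -lee_fin outerE// /tail fineK; last first.
  by rewrite fin_num_measure//; exact: measurable_abs_ge.
rewrite abs_ge_preimage; apply: le_measure; rewrite ?inE//.
- by apply: measurable_funPTI; exact: measurableU.
- by apply: measurable_funPTI; exact: measurableU.
apply: preimage_subset => x /=; rewrite !in_itv/= !andbT.
by case=> [?|/ltW]; [left|right].
Qed.

Lemma outer_le1 (t : R) : 0 < t -> outer t <= 1.
Proof.
move=> t0; rewrite -lee_fin outerE//; apply: probability_le1.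
by apply: measurable_funPTI; exact: measurableU.
Qed.

Lemma outer_convex : unimodal X 0 ->
  forall s x y : R, 0 <= s <= 1 -> 0 < x -> 0 < y ->
     outer (s * x + (1 - s) * y) <= s * outer x + (1 - s) * outer y.
Proof.
move=> [/convex_function_on_RP cN /convex_function_on_RP cP] s x y s01 x0 y0.
have := cP s x y s01; rewrite /= !in_itv/= !andbT => /(_ x0 y0).
have := cN s (- x) (- y) s01; rewrite /= !in_itv/= !oppr_lt0 => /(_ x0 y0).
rewrite (_ : s * - x + (1 - s) * - y = - (s * x + (1 - s) * y)); last by ring.
by rewrite /outer /F; lra.
Qed.

Hypothesis unimX : unimodal X 0.
Hypothesis EX : ('E_P[fun w => `|X w|%R] = 1)%E.

(** With step 2t / (n + 1) the points of the Riemann sum have midpoint t; the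
    sum loses only one step out of n + 1, which is at most [e] for [n] large. *)
Lemma outer_hermite_hadamard (t : R) : 0 < t -> 2 * t * outer t <= 1.
Proof.
move=> t0; apply/ler_addgt0Pr => e e0.
pose n := (Num.truncn (2 * t / e)).+1.
have nte : 2 * t / e < n.+1%:R.
  by apply: lt_trans (truncnS_gt _) _; rewrite ltr_nat.
pose h := 2 * t / n.+1%:R.
have h0 : 0 < h by rewrite !mulr_gt0.
have he : h <= e.
  rewrite ler_pdivrMr// -ler_pdivrMl// mulrC; exact: ltW.
have nh : n.+1%:R * h = 2 * t by rewrite mulrC divfK.
have := @midpoint_le_arithmetic_sum _ outer h n (outer_convex unimX) h0.
have -> : n.+1%:R * h / 2 = t by rewrite nh; field.
move=> mid.
have absP : measurable_fun setT (fun w => `|X w|).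
  exact: measurableT_comp.
pose Y : {RV P >-> R} := mfun_Sub (mem_set absP).
have := @expectation_ge_tail_sum _ _ _ P Y h n (ltW h0) (fun w => normr_ge0 _).
rewrite EX lee_fin => tails.
have : h * (n%:R * outer t) <= 1.
  apply: le_trans tails; rewrite ler_wpM2l ?(ltW h0)//.
  apply: le_trans mid _; apply: ler_sum => k _.
  by apply: outer_le_tail; rewrite mulr_gt0.
have -> : h * (n%:R * outer t) = 2 * t * outer t - h * outer t.
  by rewrite -nh -natr1; ring.
have := outer_le1 t t0.
nra.
Qed.

(** [outer u <= 1] and [outer 1 <= 1 / 2]; the chord joins the points of
    abscissae [u] and 1, since [outer] is convex only on the open half-line. *)
Lemma outer_chord (t u : R) : 0 < u -> u < t -> t < 1 ->
  outer t <= 1 - (t - u) / 2.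
Proof.
move=> u0 ut t1.
pose s := (1 - t) / (1 - u).
have u1 : 0 < 1 - u by lra.
have s01 : 0 <= s <= 1.
  by rewrite divr_ge0 ?(ltW u1)//= ?ler_pdivrMr//; lra.
have st : s * u + (1 - s) * 1 = t by rewrite /s; field; lra.
have := outer_convex unimX s u 1 s01 u0 ltr01; rewrite st => ch.
have o1 := outer_hermite_hadamard 1 ltr01.
have ou := outer_le1 u u0.
have : s <= 1 - (t - u) by nra.
nra.
Qed.

Lemma tail_le_inv (v : R) : 0 < v -> tail v <= 1 / (2 * v).
Proof.
move=> v0; rewrite ler_pdivlMr ?mulr_gt0//.
apply/ler_addgt0Pr => e e0.
have tail1 : tail v <= 1.
  rewrite -lee_fin /tail fineK ?probability_le1//.
    exact: measurable_abs_ge.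
  by rewrite fin_num_measure//; exact: measurable_abs_ge.
(* The first argument of the maximum keeps u positive. *)
pose u := Num.max (v / 2) (v - e / 2).
have [vu eu] : v / 2 <= u /\ v - e / 2 <= u by rewrite !le_max !lexx ?orbT.
have uv : u < v by rewrite gt_max; apply/andP; split; lra.
have u0 : 0 < u by lra.
have := tail_le_outer v u u0 uv.
have := outer_hermite_hadamard u u0.
have : 0 <= tail v by rewrite fine_ge0.
nra.
Qed.

Lemma tail_le_linear (v : R) : 0 < v -> v < 1 -> tail v <= 1 - v / 2.
Proof.
move=> v0 v1; apply/ler_addgt0Pr => e e0.
(* The tail is compared at v - r with the chord that starts at r, so the two
   limits cost r / 2 each. *)
pose r := Num.min (v / 4) (e / 2).
have [rv re] : r <= v / 4 /\ r <= e / 2 by rewrite !ge_min !lexx ?orbT.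
have r0 : 0 < r by rewrite lt_min; apply/andP; split; lra.
apply: le_trans (tail_le_outer v (v - r) _ _) _; [lra|lra|].
apply: le_trans (outer_chord (v - r) r _ _ _) _; lra.
Qed.

Lemma tail_bound_unimodal (v : R) : 0 <= v ->
  (P [set w | (v <= `|X w|)%R] <= (tail_bound v)%:E)%E.
Proof.
rewrite le_eqVlt => /predU1P[<-|v0].
  rewrite /tail_bound ler10 mul0r subr0; apply: probability_le1.
  exact: measurable_abs_ge.
rewrite -[leLHS]fineK; last first.
  by rewrite fin_num_measure//; exact: measurable_abs_ge.
rewrite lee_fin /tail_bound; case: ifPn => v1; first exact: tail_le_inv.
by apply: tail_le_linear; rewrite // ltNge.
Qed.

End tail_of_unimodal_law.
(** * The uniform law on an interval *)

Lemma uniform_probE (R : realType) (a b : R) (ab : a < b) (A : set R) :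
  measurable A ->
  uniform_prob ab A =
    ((b - a)^-1%:E * lebesgue_measure (`[a, b]%classic `&` A))%E.
Proof.
move=> mA; rewrite /uniform_prob integral_uniform_pdf setIC.
rewrite (eq_integral (fun=> (b - a)^-1%:E)).
  by rewrite integral_cst//; exact: measurableI.
by move=> x /set_mem[]/= + _; rewrite in_itv/= /uniform_pdf => ->.
Qed.

Lemma uniform_prob_lower_ray (R : realType) (a b x : R) (ab : a < b) : x <= b ->
  uniform_prob ab `]-oo, x]%classic = (Num.max 0 (x - a) / (b - a))%:E.
Proof.
move=> xb; rewrite uniform_probE//.
rewrite (_ : _ `&` _ = `[a, x]%classic); last first.
  apply/seteqP; split => y /=; rewrite !in_itv/=; lra.
rewrite lebesgue_measure_itv/= lte_fin mulrC EFinM; congr (_ * _)%E.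
case: ltP => ax; last by rewrite max_l// subr_le0.
by rewrite max_r ?subr_ge0 ?(ltW ax).
Qed.

Lemma uniform_prob_upper_ray (R : realType) (a b x : R) (ab : a < b)
    (s : bool) : a <= x ->
  uniform_prob ab [set` Interval (BSide s x) +oo%O] =
  (Num.max 0 (b - x) / (b - a))%:E.
Proof.
move=> ax; rewrite uniform_probE//.
rewrite (_ : _ `&` _ = [set` Interval (BSide s x) (BRight b)]); last first.
  by case: s; apply/seteqP; split => y /=; rewrite !in_itv/= ?andbT; lra.
rewrite lebesgue_measure_itv/= lte_fin mulrC EFinM; congr (_ * _)%E.
case: ltP => bx; last by rewrite max_l// subr_le0.
by rewrite max_r ?subr_ge0 ?(ltW bx).
Qed.

Lemma integral_abs_symmetric_itv (R : realType) (c : R) : 0 < c ->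
  (\int[lebesgue_measure]_(x in `[(- c)%R, c]) (`|x|%R)%:E = (c ^+ 2)%:E)%E.
Proof.
move=> c0.
have half (k a b : R) : a < b ->
  (\int[lebesgue_measure]_(x in `[a, b]) (k * x)%:E =
    (k / 2 * b ^+ 2)%:E - (k / 2 * a ^+ 2)%:E)%E.
  move=> ab.
  have dF (x : R) : is_derive x 1 (fun y : R => k / 2 * y ^+ 2) (k * x).
    apply: is_derive_eq; rewrite /GRing.scale/=; by field.
  refine (@continuous_FTC2 _ (fun x => k * x) (fun y => k / 2 * y ^+ 2)
    a b ab _ _ _).
  - apply: continuous_subspaceT => x.
    by apply: cvgM; [exact: cvg_cst|exact: cvg_id].
  - have cF (x : R) : {for x, continuous (fun y : R => k / 2 * y ^+ 2)}.
      exact/differentiable_continuous/derivable1_diffP/ex_derive.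
    split; first by move=> x _; exact: ex_derive.
      exact/cvg_at_right_filter/cF.
    exact/cvg_at_left_filter/cF.
  - by move=> x _; rewrite derive1E; exact: derive_val.
rewrite (_ : `[- c, c]%classic = `[- c, 0]%classic `|` `]0, c]%classic);
  last first.
  by apply/seteqP; split => x /=; rewrite !in_itv/=;
    [case: (leP x 0)|case]; lra.
have mabs (D : set R) : measurable_fun D (fun x : R => (`|x|%R)%:E).
  by apply/measurable_EFinP; exact: normr_measurable.
rewrite ge0_integral_setU//=; last 2 first.
  exact: mabs.
  apply/disj_setPS => x [] /=; rewrite !in_itv/=; lra.
rewrite integral_itv_obnd_cbnd; last exact: mabs.
have -> : (\int[lebesgue_measure]_(x in `[(- c)%R, 0%R]) (`|x|%R)%:E =
    \int[lebesgue_measure]_(x in `[(- c)%R, 0%R]) (-1 * x)%:E)%E.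
  apply: eq_integral => x /set_mem /=; rewrite in_itv/= => /andP[_ x0].
  by rewrite ler0_norm// mulN1r.
have -> : (\int[lebesgue_measure]_(x in `[0%R, c]) (`|x|%R)%:E =
    \int[lebesgue_measure]_(x in `[0%R, c]) (1 * x)%:E)%E.
  apply: eq_integral => x /set_mem /=; rewrite in_itv/= => /andP[x0 _].
  by rewrite ger0_norm// mul1r.
rewrite !half; [|lra|lra].
by rewrite -!EFinB -EFinD; congr EFin; field.
Qed.

(** * The extremal mixture *)

(** The distribution function of the mixture to the left of 0, and its opposite
    to the right of 0, have this form. *)
Lemma convex_on_max0_affine (R : realType) (a b e : R) (D : set R)
    (f : R -> R) :
  (forall s x y : R, 0 <= s <= 1 -> D x -> D y -> D (s * x + (1 - s) * y)) ->
  (forall x, D x -> f x = Num.max 0 (a + b * x) + e) ->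
  convex_function (E := R^o) D f.
Proof.
move=> cD fE; apply/convex_function_on_RP => s x y s01 Dx Dy.
have /andP[s0 s1] := s01.
rewrite !fE//; last exact: cD.
set p := Num.max 0 (a + b * x); set q := Num.max 0 (a + b * y).
have [p0 px] : 0 <= p /\ a + b * x <= p by rewrite !le_max !lexx ?orbT.
have [q0 qy] : 0 <= q /\ a + b * y <= q by rewrite !le_max !lexx ?orbT.
suff : Num.max 0 (a + b * (s * x + (1 - s) * y)) <= s * p + (1 - s) * q by lra.
rewrite ge_max; apply/andP; split; nra.
Qed.

Section extremal_mixture.
Context d (T : measurableType d) (R : realType) (P : probability T R).
Variables (X : {RV P >-> R}) (v : R).
Hypothesis v0 : 0 <= v.
Hypothesis lawX :
  forall A : set R, measurable A -> distribution P X A = extremal_law v A.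

Local Notation c := (half_width v).

Lemma half_width_ge2 : 2 <= c.
Proof. by rewrite /half_width ler_peMr// le_max lexx orbT. Qed.

Lemma half_width_ge_double : 2 * v <= c.
Proof. by rewrite /half_width ler_pM2l// le_max lexx. Qed.

(** As [c >= 2], the maximum defining the mass is attained by its first
    argument. *)
Lemma mass0E : mass0 v = 1 - 2 / c.
Proof.
rewrite /mass0 max_l// subr_ge0.
by have c2 := half_width_ge2; rewrite ler_pdivrMr; lra.
Qed.

Lemma extremal_cdf_neg (x : R) : x < 0 ->
  fine (cdf X x) = Num.max 0 (c^-1 + (c ^+ 2)^-1 * x).
Proof.
move=> x0; have c2 := half_width_ge2.
rewrite /cdf lawX// /extremal_law diracE memNset/=;
  last by rewrite in_itv/=; lra.
rewrite mule0 add0e uniform_prob_lower_ray; last by lra.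
rewrite -EFinM/= mass0E.
have -> : c^-1 + (c ^+ 2)^-1 * x = (c ^+ 2)^-1 * (x - - c) by field; lra.
have <- : (c ^+ 2)^-1 * 0 = 0 by rewrite mulr0.
by rewrite -maxr_pMr ?invr_ge0 ?sqr_ge0// mulr0; field; lra.
Qed.

(** Read off the complementary ray, which avoids the atom. *)
Lemma extremal_cdf_pos (x : R) : 0 < x ->
  - fine (cdf X x) = Num.max 0 (c^-1 + - (c ^+ 2)^-1 * x) - 1.
Proof.
move=> x0; have c2 := half_width_ge2.
rewrite cdf_1_ccdf fineB ?fin_num_measure//= opprB; congr (_ - 1).
rewrite /ccdf lawX// /extremal_law diracE memNset/=;
  last by rewrite in_itv/=; lra.
rewrite mule0 add0e uniform_prob_upper_ray; last by lra.
rewrite -EFinM/= mass0E.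
have -> : c^-1 + - (c ^+ 2)^-1 * x = (c ^+ 2)^-1 * (c - x) by field; lra.
have <- : (c ^+ 2)^-1 * 0 = 0 by rewrite mulr0.
by rewrite -maxr_pMr ?invr_ge0 ?sqr_ge0// mulr0; field; lra.
Qed.

Lemma extremal_unimodal : unimodal X 0.
Proof.
split.
- apply: (@convex_on_max0_affine _ c^-1 (c ^+ 2)^-1 0) => /=.
    move=> s x y /andP[s0 s1]; rewrite !in_itv/= => *; nra.
  by move=> x; rewrite in_itv/= addr0; exact: extremal_cdf_neg.
- apply: (@convex_on_max0_affine _ c^-1 (- (c ^+ 2)^-1) (-1)) => /=.
    move=> s x y /andP[s0 s1]; rewrite !in_itv/= !andbT => *; nra.
  by move=> x; rewrite in_itv/= andbT; exact: extremal_cdf_pos.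
Qed.

Lemma extremal_first_moment : ('E_P[fun w => `|X w|%R] = 1)%E.
Proof.
have c2 := half_width_ge2.
have m0 : 0 <= mass0 v by rewrite le_max lexx orbT.
have m1 : 0 <= 1 - mass0 v by rewrite mass0E opprB addrC subrK divr_ge0; lra.
(* The uniform law and the real line carry two convertible Borel structures with
   different displays; viewing X as valued in the former lets the two measures
   be compared. *)
pose BR : measurableType _ := measurableTypeR R.
have mX : measurable_fun setT (X : T -> BR).
  by move=> _ A mA; rewrite setTI; exact: (measurable_funPTI X).
pose XB : {mfun T >-> BR} := @mfun_Sub _ _ T BR X (mem_set mX).
have mabs : measurable_fun setT (fun x : BR => (`|x : R|%R)%:E).
  by apply/measurable_EFinP; exact: normr_measurable.
rewrite unlock.
rewrite -[LHS](@ge0_integral_distribution _ _ _ _ _ P XB _ mabs)//=.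
rewrite (eq_measure_integral (measure_add (mscale (NngNum m0) (dirac (0 : BR)))
  (mscale (NngNum m1) (uniform_prob (half_width_ltN v))))); last first.
  by move=> A mA _; rewrite [RHS]measure_addE; exact: lawX.
rewrite ge0_integral_measure_add//= !ge0_integral_mscale//= integral_dirac//.
rewrite normr0 !mule0 add0e integral_uniform//.
rewrite integral_abs_symmetric_itv; last by lra.
rewrite -!EFinM mass0E; congr EFin; field; lra.
Qed.

(** The point mass at 0 counts only when [v = 0], where it vanishes because
    [c = 2]; that case is settled by total mass instead. *)
Lemma extremal_tail : P [set w | (v <= `|X w|)%R] = (tail_bound v)%:E.
Proof.
have c2 := half_width_ge2; have cv := half_width_ge_double.
have [->|vn0] := eqVneq v 0.
  rewrite [X in P X](_ : _ = setT); last first.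
    by apply/seteqP; split => w //= _; exact: normr_ge0.
  by rewrite probability_setT /tail_bound ler10 mul0r subr0.
have vp : 0 < v by rewrite lt0r vn0.
rewrite abs_ge_preimage -[LHS]/(distribution P X _) lawX;
  last exact: measurableU.
rewrite /extremal_law diracE memNset/=; last by rewrite !in_itv/= andbT; lra.
rewrite mule0 add0e measureU//=; last first.
  by apply/seteqP; split => x //= []; rewrite !in_itv/= andbT; lra.
rewrite uniform_prob_lower_ray ?uniform_prob_upper_ray; [|lra|lra].
rewrite -EFinD -EFinM !max_r; [|lra|lra].
rewrite mass0E /tail_bound; congr EFin.
case: ifPn => [v1|].
  by rewrite /half_width max_l//; field; lra.
rewrite -ltNge => v1.
by rewrite /half_width max_r ?(ltW v1)//; field; lra.
Qed.

End extremal_mixture.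

Theorem theorem2p5 (R : realType) (d : measure_display)
    (T : measurableType d) (P : probability T R) (X : {RV P >-> R}) :
  (unimodal X 0 -> ('E_P[fun w => `|X w|%R] = 1)%E ->
   forall v : R, 0 <= v ->
     (P [set w | (v <= `|X w|)%R] <= (tail_bound v)%:E)%E) /\
  (forall v : R, 0 <= v ->
     (forall A : set R, measurable A -> distribution P X A = extremal_law v A) ->
     [/\ unimodal X 0,
         ('E_P[fun w => `|X w|%R] = 1)%E &
         P [set w | (v <= `|X w|)%R] = (tail_bound v)%:E]).
Proof.
split=> [unimX EX v v0|v v0 lawX]; first exact: tail_bound_unimodal.
split.
- exact: (@extremal_unimodal _ _ _ _ _ v).
- exact: (@extremal_first_moment _ _ _ _ _ v).
- exact: extremal_tail.
Qed.
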